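(* Let $d\in\mathbb{N}$, let $S\subseteq\mathbb{R}^d$ be a closed, regular subset, $E$ and $F$ locally convex spaces, and $R\subseteq E$ a regular subset. If the restriction map $$C^\infty(\mathbb{R}^d,F)\to C^\infty(S,F)$$ admits a continuous linear right inverse $C^\infty(S,F)\to C^\infty(\mathbb{R}^d,F)$, then also the restriction map $$C^\infty(R\times\mathbb{R}^d,F)\to C^\infty(R\times S,F)$$ admits a continuous linear right inverse.
   Context: $\mathbb{N}=\{1,2,\ldots\}$. ''Locally convex space'' means a real, Hausdorff locally convex topological vector space. A subset $R$ of a topological space is called regular if its interior $R^0$ is dense in $R$. Let $E,F$ be locally convex spaces and $R\subseteq E$ regular. A map $f\colon R\to F$ is $C^\infty$ if it is continuous and, for every $j\in\mathbb{N}$, the iterated directional derivatives $d^{(j)}f(x,y_1,\ldots,y_j):=(D_{y_j}\cdots D_{y_1}f)(x)$ exist for all $x\in R^0$, $y_1,\ldots,y_j\in E$, and the resulting function $R^0\times E^j\to F$ has a (necessarily unique) continuous extension $d^{(j)}f\colon R\times E^j\to F$; put $d^{(0)}f:=f$. The space $C^\infty(R,F)$ of such maps carries the compact-open $C^\infty$-topology, i.e. the initial topology with respect to the maps $C^\infty(R,F)\to C(R\times E^j,F)$, $f\mapsto d^{(j)}f$, $j\in\mathbb{N}_0$, where the spaces on the right have the compact-open topology. $R\times\mathbb{R}^d$ and $R\times S$ are regarded as regular subsets of $E\times\mathbb{R}^d$. *)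

(* Defs.v *)
From HB Require Import structures.
From mathcomp Require Import all_boot all_order all_algebra.
From mathcomp Require Import all_classical all_reals all_analysis.

Set Implicit Arguments.
Unset Strict Implicit.
Unset Printing Implicit Defensive.

Import Order.TTheory GRing.Theory Num.Theory numFieldNormedType.Exports.

Local Open Scope classical_set_scope.
Local Open Scope ring_scope.

(* The locally convex spaces of the library ([tvsType]) are not required to be
   Hausdorff. *)
HB.mixin Record Tvs_isHausdorff (K : numDomainType) E of Tvs K E := {
  lcs_hausdorff : hausdorff_space E
}.

#[short(type="lcsType")]
HB.structure Definition Lcs (K : numDomainType) :=
  {E of Tvs_isHausdorff K E & Tvs K E}.

HB.instance Definition _ (K : realType) (m n : nat) :=
  Tvs_isHausdorff.Build K 'M[K]_(m, n) (@norm_hausdorff K 'M[K]_(m, n)).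

Section prod_lcs.
Context (K : numFieldType) (E F : lcsType K).

Let prod_hausdorff : hausdorff_space (E * F)%type.
Proof.
move=> [x1 y1] [x2 y2] cl; congr pair; apply: lcs_hausdorff => A B nA nB.
- have nA' : nbhs (x1, y1) (A `*` [set: F]).
    by exists (A, setT) => //=; split => //; exact: filterT.
  have nB' : nbhs (x2, y2) (B `*` [set: F]).
    by exists (B, setT) => //=; split => //; exact: filterT.
  by have [[a b] [[/= ? _] [/= ? _]]] := cl _ _ nA' nB'; exists a.
- have nA' : nbhs (x1, y1) ([set: E] `*` A).
    by exists (setT, A) => //=; split => //; exact: filterT.
  have nB' : nbhs (x2, y2) ([set: E] `*` B).
    by exists (setT, B) => //=; split => //; exact: filterT.
  by have [[a b] [[/= _ ?] [/= _ ?]]] := cl _ _ nA' nB'; exists b.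
Qed.

HB.instance Definition _ :=
  Tvs_isHausdorff.Build K (E * F)%type prod_hausdorff.

End prod_lcs.

Definition regular_set {T : topologicalType} (A : set T) := A `<=` closure A°.

Section tvs_limits.
Context {K : numFieldType} {F : tvsType K} {T : Type}.
Context (G : set_system T) {FG : Filter G}.

Lemma tvs_cvgD (u w : T -> F) (l m : F) : u @ G --> l -> w @ G --> m ->
  (u t + w t) @[t --> G] --> l + m.
Proof.
apply: (@continuous2_cvg T F F F G FG u w (fun a b => a + b)).
exact: (@add_continuous F (l, m)).
Qed.

Lemma tvs_cvgZ (a : T -> K) (u : T -> F) (b : K) (l : F) :
  a @ G --> b -> u @ G --> l -> (a t *: u t) @[t --> G] --> b *: l.
Proof.
apply: (@continuous2_cvg T K^o F F G FG a u (fun a b => a *: b)).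
exact: (@scale_continuous K F (b, l)).
Qed.

Lemma tvs_cvg_lin (u w : T -> F) (a : K) (l m : F) :
  u @ G --> l -> w @ G --> m ->
  (a *: u t + w t) @[t --> G] --> a *: l + m.
Proof.
by move=> ul wm; apply: tvs_cvgD => //; apply: tvs_cvgZ => //; exact: cvg_cst.
Qed.

End tvs_limits.

Section directional_derivative.
Context {K : realType} {E F : lcsType K}.
Implicit Types (f g : E -> F) (x v : E).

(* [derive] and [derivable] of the library are restricted to normed modules. *)
Definition dquot f v x (t : K) : F := t^-1 *: (f (t *: v + x) - f x).

Definition has_dderiv f v x : Prop :=
  exists l : F, dquot f v x t @[t --> 0^'] --> l.

Definition dderiv v f x : F :=
  xget 0 [set l : F | dquot f v x t @[t --> 0^'] --> l].

(* [iter_dderiv f [:: y1; ...; yj]] is $D_{y_j} \cdots D_{y_1} f$ *)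
Definition iter_dderiv f (s : seq E) : E -> F :=
  foldl (fun g v => dderiv v g) f s.

Lemma dderivE f v x (l : F) :
  dquot f v x t @[t --> 0^'] --> l -> dderiv v f x = l.
Proof.
move=> fl; rewrite /dderiv; case: xgetP => [l' _ /= fl'|/(_ l)]; last by [].
exact: (cvg_unique (@lcs_hausdorff K F) fl' fl).
Qed.

Lemma dquot_near f g v x : {near x, f =1 g} ->
  \forall t \near (0 : K)^', dquot f v x t = dquot g v x t.
Proof.
move=> fg; have fgx : f x = g x by exact: (nbhs_singleton fg).
have c : (t *: v + x) @[t --> (0 : K)] --> x.
  rewrite -[X in _ --> X]add0r -(scale0r v).
  apply: tvs_cvgD; last exact: cvg_cst.
  by apply: (tvs_cvgZ (a := id) (u := fun=> v)); [exact: cvg_id|exact: cvg_cst].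
suff h : \forall t \near (0 : K), dquot f v x t = dquot g v x t.
  by apply: filterS h => t ht _.
have h : \forall t \near (0 : K), f (t *: v + x) = g (t *: v + x) := c _ fg.
by apply: filterS h => t /= e; rewrite /dquot e fgx.
Qed.

Lemma dquot_cvg_near f g v x (l : F) : {near x, f =1 g} ->
  dquot f v x t @[t --> 0^'] --> l -> dquot g v x t @[t --> 0^'] --> l.
Proof.
move=> fg; apply: cvg_trans; apply: near_eq_cvg.
exact: dquot_near.
Qed.

Lemma near_eqC f g x : {near x, f =1 g} -> {near x, g =1 f}.
Proof. by apply: filterS => y ->. Qed.

Lemma has_dderiv_near f g v x : {near x, f =1 g} ->
  has_dderiv f v x -> has_dderiv g v x.
Proof. by move=> fg [l fl]; exists l; exact: dquot_cvg_near fl. Qed.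

Lemma dderiv_near f g v x : {near x, f =1 g} -> dderiv v f x = dderiv v g x.
Proof.
move=> fg; rewrite /dderiv; congr xget; apply/seteqP; split=> l /=.
  exact: dquot_cvg_near.
exact/dquot_cvg_near/near_eqC.
Qed.

Lemma iter_dderiv_eq f g (O : set E) s : open O ->
  (forall x, O x -> f x = g x) ->
  forall x, O x -> iter_dderiv f s x = iter_dderiv g s x.
Proof.
move=> oO; elim: s f g => [|v s IH] f g fg /=; first exact: fg.
apply: IH => x Ox; apply: dderiv_near.
by apply: filterS (open_nbhs_nbhs (conj oO Ox)).
Qed.

Lemma iter_dderiv_rcons f s v :
  iter_dderiv f (rcons s v) = dderiv v (iter_dderiv f s).
Proof. by rewrite /iter_dderiv foldl_rcons. Qed.

Lemma dquot_lin a f g v x (l m : F) : dquot f v x t @[t --> 0^'] --> l ->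
  dquot g v x t @[t --> 0^'] --> m ->
  dquot (fun y => a *: f y + g y) v x t @[t --> 0^'] --> a *: l + m.
Proof.
move=> fl gm; apply: cvg_trans (tvs_cvg_lin (a := a) fl gm).
apply: near_eq_cvg; apply: nearW => t; rewrite /dquot.
by rewrite opprD addrACA -scalerBr [in RHS]scalerDr !scalerA (mulrC a).
Qed.

Lemma iter_dderiv_lin a f g (O : set E) : open O ->
  (forall s v x, O x -> has_dderiv (iter_dderiv f s) v x) ->
  (forall s v x, O x -> has_dderiv (iter_dderiv g s) v x) ->
  forall s x, O x -> iter_dderiv (fun y => a *: f y + g y) s x =
    a *: iter_dderiv f s x + iter_dderiv g s x.
Proof.
move=> oO df dg; elim/last_ind => [//|s v IH] x Ox.
rewrite !iter_dderiv_rcons.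
rewrite (@dderiv_near _ (fun y => a *: iter_dderiv f s y + iter_dderiv g s y));
  last first.
  by apply: filterS (open_nbhs_nbhs (conj oO Ox)).
have [l fl] := df s v x Ox; have [m gm] := dg s v x Ox.
by rewrite (dderivE fl) (dderivE gm); exact/dderivE/dquot_lin.
Qed.

Lemma dderiv_cst v (c : F) : dderiv v (cst c) = cst 0.
Proof.
apply/funext => x; apply: dderivE; rewrite (_ : dquot _ _ _ = cst 0).
  exact: cvg_cst.
by apply/funext => t; rewrite /dquot subrr scaler0.
Qed.

Lemma iter_dderiv0 s : iter_dderiv (cst 0) s = cst 0.
Proof. by elim: s => //= v s IH; rewrite dderiv_cst. Qed.

End directional_derivative.

Section smooth.
Context {K : realType} {E F : lcsType K}.
Implicit Types (R S : set E) (j : nat).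

(* [valL_ 0 f] extends f by 0 outside R; this does not affect the derivatives
   at interior points of R. *)
Definition is_dext R (f : R -> F) j
    (g : (R * {ptws 'I_j -> E})%type -> F) : Prop :=
  continuous g /\
  forall (x : R) (y : 'I_j -> E), R° (set_val x) ->
    g (x, y) = iter_dderiv ('valL_0 f) (codom y) (set_val x).

Arguments is_dext {R} f j g.

Definition smooth R (f : R -> F) : Prop :=
  [/\ continuous f,
      forall (s : seq E) (v x : E), R° x ->
        has_dderiv (iter_dderiv ('valL_0 f) s) v x &
      forall j, (0 < j)%N -> exists g, is_dext f j g].

(* $d^{(j)} f \colon R \times E^j \to F$, for smooth f and regular R *)
Definition dext R j (f : R -> F) :
    {compact-open, (R * {ptws 'I_j -> E})%type -> F} :=
  if j is 0 then fun p => f p.1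
  else xget (fun=> 0) [set g | is_dext f j g].

Arguments dext {R} j f.

Lemma valL_in R (f : R -> F) (x : E) (Rx : x \in R) :
  'valL_0 f x = f (exist _ x Rx).
Proof. exact: (congr1 (@^~ (exist _ x Rx)) (valLK 0 f)). Qed.

Lemma valL_lin R (a : K) (f g : R -> F) :
  'valL_0 (a *: f + g) = fun x => a *: 'valL_0 f x + 'valL_0 g x.
Proof.
by apply/funext => x; rewrite /valL_ /= oinv_set_val;
  case: insubP => //= *; rewrite scaler0 addr0.
Qed.

Lemma smooth0 R : smooth (0 : R -> F).
Proof.
have v0 : 'valL_0 (0 : R -> F) = cst 0.
  by apply/funext => x; rewrite /valL_ /=; rewrite oinv_set_val; case: insubP.
split.
- exact: (@cst_continuous R F 0).
- move=> s v x _; exists 0; rewrite v0 iter_dderiv0.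
  rewrite (_ : dquot _ _ _ = cst 0); first exact: cvg_cst.
  by apply/funext => t; rewrite /dquot subrr scaler0.
- move=> j _; exists (cst 0); split.
    exact: (@cst_continuous (R * {ptws 'I_j -> E})%type F 0).
  by move=> x y _; rewrite v0 iter_dderiv0.
Qed.

Lemma smooth_lin R (a : K) (f g : R -> F) :
  smooth f -> smooth g -> smooth (a *: f + g).
Proof.
move=> [cf df ef] [cg dg eg].
have lin := iter_dderiv_lin a (open_interior R) df dg.
split.
- move=> x; exact: (tvs_cvg_lin (a := a) (cf x) (cg x)).
- move=> s v x Rx; have [l fl] := df s v x Rx; have [m gm] := dg s v x Rx.
  exists (a *: l + m); rewrite valL_lin.
  apply: dquot_cvg_near (dquot_lin (a := a) fl gm).
  have := open_nbhs_nbhs (conj (open_interior R) Rx).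
  by apply: filterS => y Ry; rewrite lin.
- move=> j j0; have [u [cu fu]] := ef j j0; have [w [cw gw]] := eg j j0.
  exists (fun p => a *: u p + w p); split.
    move=> x; exact: (tvs_cvg_lin (a := a) (cu x) (cw x)).
  by move=> x y Rx; rewrite fu// gw// valL_lin lin.
Qed.

Definition smooth_pred R : {pred R -> F} := [pred f | `[< smooth f >]].

Lemma smooth_submod_closed R : submod_closed (@smooth_pred R).
Proof.
split; first exact/asboolP/smooth0.
by move=> a f g /asboolP sf /asboolP sg; exact/asboolP/smooth_lin.
Qed.

HB.instance Definition _ R :=
  GRing.isSubmodClosed.Build K (R -> F) (@smooth_pred R) 
    (GRing.submod_closed_semi (@smooth_submod_closed R)).

(* $C^\infty(R, F)$ *)
Record Cinfty R := MkCinfty {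
  Cinfty_fun :> R -> F ;
  Cinfty_smooth : Cinfty_fun \in @smooth_pred R
}.

HB.instance Definition _ R := [isSub for @Cinfty_fun R].
HB.instance Definition _ R := [Choice of Cinfty R by <:].
HB.instance Definition _ R := [SubChoice_isSubLmodule of Cinfty R by <:].

Lemma dextP R j (f : Cinfty R) : is_dext f j (dext j f).
Proof.
case: f => f /= /asboolP [cf df ef]; case: j => [|j]; last first.
  rewrite /dext; case: xgetP => [? _ //|].
  by have [g hg] := ef j.+1 isT => /(_ g).
split.
  move=> x; apply: (@continuous_comp _ _ _ fst f) ; [exact: cvg_fst|exact: cf].
move=> [x Rx] y _ /=; rewrite (_ : codom y = [::]); last first.
  by apply: size0nil; rewrite size_codom card_ord.
exact: (esym (valL_in f Rx)).
Qed.

Lemma is_dext_uniq R j (f : R -> F) g h : regular_set R ->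
  is_dext f j g -> is_dext f j h -> g = h.
Proof.
move=> rR [cg fg] [ch fh]; apply/funext => -[x y].
apply: (@lcs_hausdorff K F) => A B nA nB.
have nA' := cg _ _ nA; have nB' := ch _ _ nB.
have [[P Q] /= [[P' [[P'' oP'' <-] P''x P'P]] nQ] PQ] :
    nbhs (x, y) ((g @^-1` A) `&` (h @^-1` B)) by exact: filterI.
have [z [iz Pz]] : (R° `&` P'') !=set0.
  by apply: rR; [exact: set_mem (valP x)|exact: open_nbhs_nbhs].
pose z' : R := exist _ z (mem_set (interior_subset iz)).
have [/= ? ?] : ((g @^-1` A) `&` (h @^-1` B)) (z', y).
  by apply: PQ; split => /=; [exact: P'P|exact: nbhs_singleton].
by exists (g (z', y)); split => //; rewrite fg// -fh.
Qed.

Definition Cinfty_topology R := sup_topology (fun j : nat =>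
  Topological.class (initial_topology (fun f : Cinfty R => dext j f))).

HB.instance Definition _ R := Topological.copy (Cinfty R) (Cinfty_topology R).

Definition incl R S (RS : R `<=` S) (x : R) : S :=
  exist _ (set_val x) (mem_set (RS _ (set_valP x))).

Lemma incl_continuous R S (RS : R `<=` S) : continuous (incl RS).
Proof.
apply: continuous_comp_initial.
exact: initial_continuous.
Qed.

Lemma smooth_restr R S (RS : R `<=` S) (f : S -> F) :
  smooth f -> smooth (f \o incl RS).
Proof.
move=> [cf df ef].
have RS' : R° `<=` S° by exact: interiorS.
have fE x : R° x -> 'valL_0 (f \o incl RS) x = 'valL_0 f x.
  move=> /interior_subset Rx.
  rewrite (valL_in _ (mem_set Rx)) (valL_in _ (mem_set (RS _ Rx))) /=.
  by congr f; exact: val_inj.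
have itE := iter_dderiv_eq _ (open_interior R) fE.
split.
- move=> x; apply: continuous_comp; [exact: incl_continuous|exact: cf].
- move=> s v x Rx; apply: has_dderiv_near (df s v x (RS' _ Rx)).
  have := open_nbhs_nbhs (conj (open_interior R) Rx).
  by apply: filterS => y Ry; rewrite itE.
- move=> j j0; have [g [cg fg]] := ef j j0.
  exists (fun p => g (incl RS p.1, p.2)); split; last first.
    by move=> x y Rx; rewrite fg ?itE//; exact: RS'.
  move=> p; apply: (@continuous_comp _ _ _ (fun p => (incl RS p.1, p.2)) g).
    apply: (@cvg_pair _ _ _ _ (nbhs (incl RS p.1)) (nbhs p.2)).
      by apply: continuous_comp; [exact: cvg_fst|exact: incl_continuous].
    exact: cvg_snd.
  exact: cg.
Qed.

Lemma restr_subproof R S (RS : R `<=` S) (f : Cinfty S) :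
  f \o incl RS \in @smooth_pred R.
Proof. exact/asboolP/smooth_restr/asboolP/Cinfty_smooth. Qed.

(* the restriction map $C^\infty(S, F) \to C^\infty(R, F)$ *)
Definition restr R S (RS : R `<=` S) (f : Cinfty S) : Cinfty R :=
  MkCinfty (restr_subproof RS f).

End smooth.
Arguments dext {K E F R} j f.
Arguments is_dext {K E F R} f j g.
Arguments Cinfty {K E} F R.

Definition has_clin_right_inverse {K : numDomainType}
    {V W : preTopologicalLmodType K} (r : V -> W) : Prop :=
  exists Phi : {linear W -> V}, continuous Phi /\ cancel Phi r.

(* Main.v *)
(* Let Phi be the given extension operator from S to R^d. The extension of f is
   (x, y) |-> Phi (f (x, .)) y. A smooth function is encoded by its jet, the
   family of all d^{(j)} f; conversely a family that is jointly continuous and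
   closed under directional differentiation is the jet of a smooth function.
   By the mean value theorem, in the form "difference quotients lie in any
   convex set whose interior contains the derivatives", limits of jets are jets.
   This yields at once that the fibers f (x, .) are smooth for boundary points x
   of R, that D_u and D_v commute for u in E and v in R^d, and that the fibers
   depend differentiably on x, as elements of C^oo(S, F), with derivatives the
   fibers of the partial derivatives of f. Being linear and continuous, Phi
   preserves this, and the jet of the extension is given by the Leibniz rule.
   Convergence in the compact-open C^oo-topology is continuous convergence of
   jets on compact sets; this translates continuity of Phi into joint continuity
   of the jet of the extension, and into continuity of f |-> extension f. *)

Require Import Defs.
From HB Require Import structures.
From mathcomp Require Import all_boot all_order all_algebra.
From mathcomp Require Import all_classical all_reals all_analysis.
From mathcomp Require Import ring lra.
Import Order.TTheory GRing.Theory Num.Theory numFieldNormedType.Exports.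

Set Implicit Arguments.
Unset Strict Implicit.
Unset Printing Implicit Defensive.

Local Open Scope classical_set_scope.
Local Open Scope ring_scope.

(** * Mean value theorem and limits of derivatives *)

Section mean_value.
Context {K : realType} {E F : lcsType K}.

Definition convex_comb_closed (C : set F) := forall (a b : K) (x y : F),
  0 <= a -> 0 <= b -> a + b = 1 -> C x -> C y -> C (a *: x + b *: y).

(** Regularity first shrinks [W] to a neighbourhood whose closure stays in [W]; local convexity then
    gives an open convex [C] inside that one. The closure is controlled because limits of points of
    [C] will be taken. *)
Lemma nbhs_convex (l : F) (W : set F) : nbhs l W ->
  exists C : set F, [/\ convex_comb_closed C, open C, C l & closure C `<=` W].
Proof.
move=> /(@uniform_regular F l)[V nV VW].
have [B Bconv [Bopen Bbasis]] := @locally_convex K F.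
have [C [BC Cl] CV] := Bbasis l V nV.
exists C; split => //; first last.
- by move=> y /(closureS CV) /VW.
- exact: Bopen.
move=> a b x y a0 b0 ab Cx Cy.
have a01 : Itv.spec (@Itv.num_sem K) (Itv.Real `[0%Z, 1%Z]) a.
  rewrite /= /Itv.num_sem /= realE a0 /= in_itv /= a0 /=; lra.
have := Bconv C (mem_set BC) x y (Itv.Def a01) (mem_set Cx) (mem_set Cy).
rewrite inE /conv /=.
have -> : unstable.onem a = b by rewrite /unstable.onem -ab addrAC subrr add0r.
by [].
Qed.

(** A continuous induction on $[0,t]$: the set [A] of those [b] whose slope from 0 lies in [C]
    contains its supremum, and the supremum cannot stay below [t]. *)
Lemma mean_value (h : K -> F) (C : set F) (t : K) : convex_comb_closed C ->
  0 < t ->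
  (forall s, 0 <= s <= t ->
    \forall r \near 0^', C (r^-1 *: (h (r + s) - h s))) ->
  C (t^-1 *: (h t - h 0)).
Proof.
move=> cC t0 hC.
pose A : set K := [set b | 0 < b <= t /\ C (b^-1 *: (h b - h 0))].
have hC' s : 0 <= s <= t -> exists2 e : K, 0 < e &
    forall r, `|r| < e -> r != 0 -> C (r^-1 *: (h (r + s) - h s)).
  move=> /hC [e /= e0 he]; exists e => // r re r0.
  by apply: he => //=; rewrite sub0r normrN.
(* The slope over $[0,c]$ is the convex combination, with weights $b/c$ and $(c-b)/c$, of the slopes
   over $[0,b]$ and $[b,c]$. *)
have comb b c : 0 < b -> b < c -> C (b^-1 *: (h b - h 0)) ->
    C ((c - b)^-1 *: (h c - h b)) -> C (c^-1 *: (h c - h 0)).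
  move=> b0 bc Cb Cc.
  have -> : c^-1 *: (h c - h 0) = (b / c) *: (b^-1 *: (h b - h 0)) +
      ((c - b) / c) *: ((c - b)^-1 *: (h c - h b)).
    rewrite !scalerA (_ : b / c / b = c^-1); last by field; lra.
    rewrite (_ : (c - b) / c / (c - b) = c^-1); last by field; lra.
    by rewrite -scalerDr [X in _ = _ *: X]addrC addrA subrK.
  apply: cC => //; [apply: divr_ge0; lra|apply: divr_ge0; lra|field; lra].
have [|e0 e0_gt0 he0] := hC' 0; first by rewrite lexx ltW.
have A0 : A (Num.min t (e0 / 2)).
  have m0 : 0 < Num.min t (e0 / 2) by rewrite lt_min t0 /=; lra.
  split; first by rewrite m0 ge_min lexx.
  rewrite -[X in h X](addr0 (Num.min t (e0 / 2))); apply: he0;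
    last by rewrite gt_eqF.
  by rewrite gtr0_norm// gt_min; apply/orP; right; lra.
have hsA : has_sup A by split; [eexists; exact: A0|exists t => b [/andP[]]].
pose c := sup A.
have c0 : 0 < c.
  by have /(lt_le_trans (andP A0.1).1) := sup_upper_bound hsA A0.
have ct : c <= t by apply: sup_le_ub; [exact: hsA.1|move=> b [/andP[]]].
have [|e e_gt0 he] := hC' c; first by rewrite ltW.
(* Some [b] in [A] is closer to [c] than [e]; the local hypothesis at [c] with the negative
   increment [b - c] handles the remaining piece $[b,c]$. *)
have Ac : A c.
  have [b Ab] := sup_adherent e_gt0 hsA; rewrite -/c => eb.
  have bc : b <= c by have := sup_upper_bound hsA Ab.
  have [bE|bNc] := eqVneq b c; first by rewrite -bE.
  have {}bc : b < c by rewrite lt_neqAle bNc.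
  case: Ab => /andP[b0 bt] Cb; split; first by rewrite c0.
  apply: (comb b c b0 bc Cb).
  have : C ((b - c)^-1 *: (h (b - c + c) - h c)).
    by apply: he; [rewrite ltr0_norm; lra|rewrite subr_eq0 lt_eqF].
  by rewrite subrK -[b - c]opprB invrN scaleNr -scalerN opprB.
have [<-|cNt] := eqVneq c t; first by case: Ac.
have {cNt}ct' : c < t by rewrite lt_neqAle cNt.
(* An increment small enough for the local hypothesis at [c] and not leading beyond [t]; then
   [r + c] lies in [A], against the choice of [c]. *)
pose r := Num.min (t - c) (e / 2).
have r0 : 0 < r by rewrite lt_min; lra.
have re : r < e by rewrite gt_min; apply/orP; right; lra.
have rt : r <= t - c by rewrite ge_min lexx.
suff : A (r + c) by move=> /(sup_upper_bound hsA); rewrite -/c; lra.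
split; first lra.
apply: (comb c) => //; [lra|by case: Ac|].
rewrite addrK; apply: he; first by rewrite gtr0_norm.
by rewrite gt_eqF.
Qed.

Lemma mean_value_dquot (g : E -> F) (v x : E) (C : set F) (t : K) :
  convex_comb_closed C -> t != 0 ->
  (forall s, `|s| <= `|t| ->
    \forall r \near 0^', C (dquot g v (s *: v + x) r)) ->
  C (dquot g v x t).
Proof.
move=> cC; rewrite neq_lt => /orP[] t0 hC; last first.
  have /= := @mean_value (fun s => g (s *: v + x)) C t cC t0.
  rewrite scale0r add0r; apply=> s /andP[s0 st].
  have := hC s; rewrite !ger0_norm ?(ltW t0)// => /(_ st).
  by apply: filterS => r; rewrite /dquot scalerDl addrA.
(* For negative [t] the segment is traversed from [t *: v + x] to [x], so that the parameter again
   runs upwards from 0. *)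
have nt0 : 0 < - t by rewrite oppr_gt0.
have /= := @mean_value (fun s => g ((s + t) *: v + x)) C (- t) cC nt0.
rewrite addNr add0r scale0r add0r invrN scaleNr -scalerN opprB.
move=> H; apply: H => s /andP[s0 st].
have st' : `|s + t| <= `|t| by rewrite ler0_norm ?ler0_norm; lra.
have := hC (s + t) st'.
by apply: filterS => r; rewrite /dquot addrA -scalerDl (addrA r).
Qed.

Lemma cvg_line {T : Type} (G : set_system T) {FG : Filter G} (t : T -> K)
    (v x : E) : t @ G --> 0 -> (t p *: v + x) @[p --> G] --> x.
Proof.
move=> t0; rewrite -[X in _ --> X]add0r -(scale0r v).
apply: tvs_cvgD; last exact: cvg_cst.
by apply: tvs_cvgZ => //; exact: cvg_cst.
Qed.

(** Near [x] the derivatives lie in a convex [C], so by the mean value theorem the quotients of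
    [g p] lie in [C] for all [p] in one set [P] of [G] and all small [t]. For fixed [t], letting [p]
    run along [G] puts the quotient of [gl] into [closure C], hence into [W]. *)
Lemma dquot_lim {T : Type} (G : set_system T) {FG : ProperFilter G}
    (g g' : T -> E -> F) (gl : E -> F) (v x : E) (l : F) :
  (\forall p \near filter_prod G (nbhs x),
    dquot (g p.1) v p.2 r @[r --> 0^'] --> g' p.1 p.2) ->
  g' p.1 p.2 @[p --> filter_prod G (nbhs x)] --> l ->
  (\forall y \near x, g p y @[p --> G] --> gl y) ->
  dquot gl v x r @[r --> 0^'] --> l.
Proof.
move=> gg' g'l ggl W nW.
have [C [cC oC Cl CW]] := nbhs_convex nW.
have nC : nbhs l C by exact: open_nbhs_nbhs.
have [[P Q] /= [GP nQ] PQ] := filterI gg' (g'l _ nC).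
have [e /= e0 he] := cvg_line v cvg_id (filterI nQ ggl).
suff : \forall t \near (0 : K)^', W (dquot gl v x t) by [].
near=> t; apply: CW => /=.
have te : `|t| < e.
  near: t; exists e => //= s /=; by rewrite sub0r normrN.
have tn0 : t != 0 by near: t; exact: nbhs_dnbhs_neq.
have inC p : P p -> C (dquot (g p) v x t).
  move=> Pp; apply: mean_value_dquot => // s st.
  have [] := he s.
    by rewrite /= sub0r normrN; exact: le_lt_trans te.
  move=> Qs _; have [/= d1 Cd] := PQ (p, s *: v + x) (conj Pp Qs).
  by apply: d1; apply: open_nbhs_nbhs.
have cg : dquot (g p) v x t @[p --> G] --> dquot gl v x t.
  rewrite /dquot; apply: tvs_cvgZ; first exact: cvg_cst.
  apply: tvs_cvgD.
    by have [] := he t; rewrite //= sub0r normrN.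
  rewrite -scaleN1r; under eq_fun do rewrite -scaleN1r.
  apply: tvs_cvgZ; first exact: cvg_cst.
  exact: nbhs_singleton ggl.
move=> B /cg; rewrite /nbhs /= => GB.
have {}GB : G (fun p => B (dquot (g p) v x t)) by [].
have [p [Pp Bp]] := filter_ex (filterI GP GB).
by exists (dquot (g p) v x t); split => //; exact: inC.
Unshelve. all: by end_near. Qed.

End mean_value.

(** * Convergence and tightness of lists of vectors *)

Section sequences_of_vectors.
Context {E : topologicalType} (x0 : E) {T : Type} (G : set_system T).

Definition seq_cvg (s : T -> seq E) (s0 : seq E) :=
  (forall t, size (s t) = size s0) /\
  forall i, nth x0 (s t) i @[t --> G] --> nth x0 s0 i.

(** Families that eventually stay in one compact subset of [A] are those along which compact-open
    convergence can be evaluated. *)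
Definition tight (A : set E) (xi : T -> E) :=
  exists C : set E, [/\ compact C, C `<=` A & \forall t \near G, C (xi t)].

Definition tight_seq (s : T -> seq E) :=
  forall i, tight setT (fun t => nth x0 (s t) i).

End sequences_of_vectors.

Section sequences_of_vectors_theory.
Context {E : topologicalType} (x0 : E) {T : Type} (G : set_system T)
  {FG : Filter G}.

Lemma seq_cvg_cst s0 : seq_cvg x0 G (fun=> s0) s0.
Proof. by split=> // i; exact: cvg_cst. Qed.

Lemma tight_cst (A : set E) x : A x -> tight G A (fun=> x).
Proof.
move=> Ax; exists [set x].
by split; [exact: compact_set1|move=> _ ->|exact: nearW].
Qed.

Lemma tight_seq_cst s0 : tight_seq x0 G (fun=> s0).
Proof. by move=> i; apply: tight_cst. Qed.

Lemma seq_cvg_cat (s1 s2 : T -> seq E) s10 s20 : seq_cvg x0 G s1 s10 ->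
  seq_cvg x0 G s2 s20 -> seq_cvg x0 G (fun t => s1 t ++ s2 t) (s10 ++ s20).
Proof.
move=> [z1 c1] [z2 c2]; split=> [t|i]; first by rewrite !size_cat z1 z2.
have -> : (fun t => nth x0 (s1 t ++ s2 t) i) = if (i < size s10)%N
    then fun t => nth x0 (s1 t) i else fun t => nth x0 (s2 t) (i - size s10).
  by apply/funext => t; rewrite nth_cat z1; case: ifP.
rewrite nth_cat.
by case: ifP => _; [exact: c1|exact: c2].
Qed.

Lemma tight_seq_cat (s1 s2 : T -> seq E) n :
  (forall t, size (s1 t) = n) -> tight_seq x0 G s1 ->
  tight_seq x0 G s2 -> tight_seq x0 G (fun t => s1 t ++ s2 t).
Proof.
move=> z1 c1 c2 i.
have -> : (fun t => nth x0 (s1 t ++ s2 t) i) = if (i < n)%N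
    then fun t => nth x0 (s1 t) i else fun t => nth x0 (s2 t) (i - n).
  by apply/funext => t; rewrite nth_cat z1; case: ifP.
by case: ifP => _; [exact: c1|exact: c2].
Qed.

Lemma seq_cvg_rcons (s : T -> seq E) (v : T -> E) s0 v0 : seq_cvg x0 G s s0 ->
  v @ G --> v0 -> seq_cvg x0 G (fun t => rcons (s t) (v t)) (rcons s0 v0).
Proof.
move=> cs cv; rewrite -cats1.
have -> : (fun t => rcons (s t) (v t)) = (fun t => s t ++ [:: v t]).
  by apply/funext => t; rewrite cats1.
by apply: seq_cvg_cat => //; split=> // -[|[|i]] //=; exact: cvg_cst.
Qed.

Lemma tight_seq_rcons (s : T -> seq E) (v : T -> E) n :
  (forall t, size (s t) = n) -> tight_seq x0 G s -> tight G setT v ->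
  tight_seq x0 G (fun t => rcons (s t) (v t)).
Proof.
move=> z cs cv.
have -> : (fun t => rcons (s t) (v t)) = (fun t => s t ++ [:: v t]).
  by apply/funext => t; rewrite cats1.
apply: (tight_seq_cat z) => // -[//|i].
rewrite (_ : (fun t => _) = fun=> x0); first exact: tight_cst.
by apply/funext => t /=; rewrite nth_nil.
Qed.

Lemma tight_comp {T' : Type} (H : set_system T') (pi : T' -> T) (A : set E)
  (xi : T -> E) : pi @ H --> G -> tight G A xi -> tight H A (xi \o pi).
Proof.
by move=> piG [C [cC CA GC]]; exists C; split => //; exact: (piG _ GC).
Qed.

Lemma tight_pair {E' : topologicalType} (A : set E) (A' : set E') xi xi' :
  tight G A xi -> tight G A' xi' ->
  tight G (A `*` A') (fun t => (xi t, xi' t)).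
Proof.
move=> [C [cC CA GC]] [C' [cC' CA' GC']]; exists (C `*` C'); split.
- exact: compact_setX.
- exact: setSX.
- by apply: filterS2 GC GC'.
Qed.

Lemma tight_map {E' : topologicalType} (A : set E) (B : set E') (h : E -> E')
  xi : continuous h -> A `<=` h @^-1` B -> tight G A xi -> tight G B (h \o xi).
Proof.
move=> ch AB [C [cC CA GC]]; exists (h @` C); split.
- by apply: continuous_compact => //; exact: continuous_subspaceT.
- by move=> _ [x /CA/AB ? <-].
- by apply: filterS GC => t ?; exists (xi t).
Qed.

End sequences_of_vectors_theory.

Lemma seq_cvg_map {E E' : topologicalType} (x0 : E) (x0' : E') {T : Type}
    (G : set_system T) {FG : Filter G} (h : E -> E') s s0 :
  continuous h -> h x0 = x0' ->
  seq_cvg x0 G s s0 -> seq_cvg x0' G (fun t => map h (s t)) (map h s0).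
Proof.
move=> ch h0 [zs cs]; split=> [t|i]; first by rewrite !size_map.
have nthE (r : seq E) : nth x0' (map h r) i = h (nth x0 r i).
  have [ir|ri] := ltnP i (size r); first exact: nth_map.
  by rewrite !nth_default ?size_map.
rewrite nthE (_ : (fun t => _) = fun t => h (nth x0 (s t) i)); last first.
  by apply/funext => t.
by apply: continuous_cvg; [exact: ch|exact: cs].
Qed.

Lemma tight_seq_map {E E' : topologicalType} (x0 : E) (x0' : E') {T : Type}
    (G : set_system T) {FG : Filter G} (h : E -> E') s :
  continuous h -> h x0 = x0' ->
  tight_seq x0 G s -> tight_seq x0' G (fun t => map h (s t)).
Proof.
move=> ch h0 ts i.
have nthE (r : seq E) : nth x0' (map h r) i = h (nth x0 r i).
  have [ir|ri] := ltnP i (size r); first exact: nth_map.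
  by rewrite !nth_default ?size_map.
rewrite (_ : (fun t => _) = h \o (fun t => nth x0 (s t) i)); last first.
  by apply/funext => t /=.
by apply: (tight_map ch _ (ts i)).
Qed.

Lemma seq_cvg_comp {E : topologicalType} (x0 : E) {T T' : Type}
    (G : set_system T) (H : set_system T') (pi : T' -> T) s s0 :
  pi @ H --> G -> seq_cvg x0 G s s0 -> seq_cvg x0 H (s \o pi) s0.
Proof.
move=> piG [zs cs]; split=> [t|i]; first exact: zs.
by apply: cvg_comp (cs i); exact: piG.
Qed.

Lemma compact_set_type {T : topologicalType} (A C : set T) : C `<=` A ->
  compact C -> compact ((set_val : A -> T) @^-1` C).
Proof.
move=> CA cC H PH HC.
have [x [Cx clx]] := cC (set_val @ H) _ HC.
pose x' : A := exist _ x (mem_set (CA _ Cx)).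
exists x'; split => // B D HB [/= D' [[D'' oD'' <-] D''x D'D]].
have [_ [[b Bb <-] D''b]] : (((set_val : A -> T) @` B) `&` D'') !=set0.
  apply: clx; last exact: open_nbhs_nbhs.
  by apply: (@filterS _ H _ B) => // b Bb; exists b.
by exists b; split => //; exact: D'D.
Qed.

(** * Jets *)

Section jets.
Context {K : realType} {E F : lcsType K}.
Implicit Types (A : set E).

(* [jet f x [:: y1; ...; yj]] is $d^{(j)} f(x, y_1, ..., y_j)$; it is junk for
   [x] outside the domain of [f] *)
Definition jet A (f : Cinfty F A) (x : E) (s : seq E) : F :=
  'valL_0 (fun z : A => dext (size s) f
    (z, (fun i : 'I_(size s) => s`_i) : {ptws 'I_(size s) -> E})) x.

Definition jet_deriv A (J : E -> seq E -> F) := forall s v x, A° x ->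
  dquot (J^~ s) v x t @[t --> 0^'] --> J x (rcons s v).

(** Joint continuity on [A] in the point and the directions, phrased with filters because the
    directions form a list, which carries no topology here; [seq_cvg] stands in for it. *)
Definition jet_cont A (J : E -> seq E -> F) :=
  forall (T : Type) (G : set_system T) (xi : T -> E) x s s0, Filter G ->
    xi @ G --> x -> (\forall t \near G, A (xi t)) -> A x -> seq_cvg 0 G s s0 ->
    J (xi t) (s t) @[t --> G] --> J x s0.

Lemma dext_jet A (f : Cinfty F A) j (x : A) s : size s = j ->
  dext j f (x, (fun i : 'I_j => s`_i) : {ptws 'I_j -> E}) = jet f (val x) s.
Proof.
move=> <-; case: x => x Ax; rewrite /jet.
by rewrite (valL_in _ Ax).
Qed.

Lemma nth_codom_ord j (y : 'I_j -> E) (i : 'I_j) : (codom y)`_i = y i.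
Proof.
by rewrite (nth_map i) ?size_enum_ord// nth_ord_enum.
Qed.

Lemma dext_jet_codom A (f : Cinfty F A) j (x : A) (y : {ptws 'I_j -> E}) :
  dext j f (x, y) = jet f (val x) (codom y).
Proof.
rewrite -(@dext_jet A f j); last by rewrite size_codom card_ord.
by congr (dext j f (_, _)); apply/funext => i; rewrite nth_codom_ord.
Qed.

Lemma codom_nth (s : seq E) : codom (fun i : 'I_(size s) => s`_i) = s.
Proof.
apply: (@eq_from_nth _ 0); rewrite ?size_codom ?card_ord// => i si.
by rewrite (nth_codom_ord _ (Ordinal si)).
Qed.

Lemma jet_nil A (f : Cinfty F A) (x : A) : jet f (val x) [::] = f x.
Proof. by rewrite -(@dext_jet A f 0 x [::]). Qed.

Lemma jet_iter_dderiv A (f : Cinfty F A) x s : A° x ->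
  jet f x s = iter_dderiv ('valL_0 f) s x.
Proof.
move=> Ax; have Ax' := mem_set (interior_subset Ax).
have [_ /(_ (exist _ x Ax'))] := dextP (size s) f.
move=> /(_ (fun i : 'I_(size s) => s`_i) Ax).
by rewrite dext_jet// codom_nth.
Qed.

Lemma jet_jet_deriv A (f : Cinfty F A) : jet_deriv A (jet f).
Proof.
move=> s v x Ax.
have /asboolP[_ df _] := Cinfty_smooth f.
have [l fl] := df s v x Ax.
rewrite jet_iter_dderiv// iter_dderiv_rcons (dderivE fl).
apply: dquot_cvg_near fl.
have := open_nbhs_nbhs (conj (open_interior A) Ax).
by apply: filterS => y Ay; rewrite jet_iter_dderiv.
Qed.

Lemma cvg_codom A j (p : A * {ptws 'I_j -> E}) :
  (set_val q.1 @[q --> p] --> set_val p.1) /\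
  seq_cvg 0 (nbhs p) (fun q : A * {ptws 'I_j -> E} => codom q.2) (codom p.2).
Proof.
split.
  apply: (@cvg_comp _ _ _ fst set_val); first exact: cvg_fst.
  exact: initial_continuous.
split=> [q|i]; first by rewrite !size_codom.
have [ij|ji] := ltnP i j; last first.
  rewrite nth_default ?size_codom ?card_ord//.
  rewrite (_ : (fun t => _) = fun=> 0); first exact: cvg_cst.
  by apply/funext => q; rewrite nth_default ?size_codom ?card_ord.
rewrite (nth_codom_ord _ (Ordinal ij)).
rewrite (_ : (fun t => _) =
    (fun y : {ptws 'I_j -> E} => y (Ordinal ij)) \o snd); last first.
  by apply/funext => q /=; rewrite (nth_codom_ord _ (Ordinal ij)).
apply: cvg_comp; first exact: cvg_snd.
exact: (@proj_continuous 'I_j (fun=> E) (Ordinal ij) p.2).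
Qed.

Lemma cvg_nth_ptws {T : Type} (G : set_system T) {FG : Filter G} s s0 :
  seq_cvg (0 : E) G s s0 ->
  ((fun i : 'I_(size s0) => (s t)`_i) : {ptws 'I_(size s0) -> E})
    @[t --> G] --> ((fun i => s0`_i) : {ptws 'I_(size s0) -> E}).
Proof.
move=> [_ cs].
apply/cvg_sup => i U [V [[W oW <-] Wf WU]].
apply: filterS WU _; apply: (cs i).
exact: open_nbhs_nbhs.
Qed.

Lemma nbhs_set_type A (x : A) (P : set A) : nbhs x P ->
  exists2 Q : set E, nbhs (val x) Q & forall y : A, Q (val y) -> P y.
Proof.
move=> [P' [[Q oQ <-] Qx QP]]; exists Q => //; exact: open_nbhs_nbhs.
Qed.

Definition jetpt A j (x : E) (Ax : A x) (s : seq E) :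
    (A * {ptws 'I_j -> E})%type :=
  (exist _ x (mem_set Ax), (fun i : 'I_j => s`_i) : {ptws 'I_j -> E}).

Lemma dext_jetpt A (f : Cinfty F A) j x (Ax : A x) s : size s = j ->
  dext j f (jetpt j Ax s) = jet f x s.
Proof. exact: dext_jet. Qed.

Lemma Cinfty_cvgP A (T : Type) (G : set_system T) (theta : T -> Cinfty F A)
    (f0 : Cinfty F A) :
  Filter G ->
  theta @ G --> f0 <-> forall j, dext j (theta t) @[t --> G] --> dext j f0.
Proof.
move=> FG.
have := @cvg_sup _ _ (fun j => Topological.class
    (initial_topology (fun f : Cinfty F A => dext j f))) (theta @ G) f0 _.
move=> /(_ (fmap_filter _ _)) h; split.
  move=> /(iffLR h) {}h j U nU.
  have /= := @initial_continuous _ _ (fun f : Cinfty F A => dext j f) f0 U nU.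
  by move=> /h.
move=> {}H; apply: (iffRL h) => j U [B [[Q oQ <-] Qf0 BU]].
apply: filterS BU _; apply: (H j).
exact: open_nbhs_nbhs.
Qed.

(* Evaluation [(f, x, s) |-> jet f x s] is jointly continuous as long as [f] is
   fixed, or the point and the directions stay in compact sets. *)
Lemma jet_cvg A (T : Type) (G : set_system T) (f : T -> Cinfty F A) f0
    (xi : T -> E) x s s0 : Filter G ->
  (forall t, f t = f0) \/ [/\ f @ G --> f0, tight G A xi & tight_seq 0 G s] ->
  xi @ G --> x -> (\forall t \near G, A (xi t)) -> A x -> seq_cvg 0 G s s0 ->
  jet (f t) (xi t) (s t) @[t --> G] --> jet f0 x s0.
Proof.
move=> FG ff0 xix Axi Ax ss0 W nW.
(* The margin between [closure V] and the interior of [W] leaves room to replace [f0] by a nearby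
   [f t]. *)
have [V nV VW] := @uniform_regular F _ _ (nbhs_interior nW).
pose k0 := jetpt (size s0) Ax s0.
have jetE0 : dext _ f0 k0 = jet f0 x s0 by exact: dext_jetpt.
have [cf0 _] := dextP (size s0) f0.
have [[P Q] /= [nP nQ] PQ] : nbhs k0 (dext _ f0 @^-1` V).
  by apply: cf0; rewrite jetE0.
have [P' nP' P'P] := nbhs_set_type nP.
have GP : \forall t \near G, P' (xi t) := xix _ nP'.
have GQ : \forall t \near G,
    Q ((fun i : 'I_(size s0) => (s t)`_i) : {ptws 'I_(size s0) -> E}) 
  by exact: (@cvg_nth_ptws _ _ FG _ _ ss0 _ nQ).
have inV t (Axt : A (xi t)) : P' (xi t) ->
    Q (fun i : 'I_(size s0) => (s t)`_i) ->
    V (dext (size s0) f0 (jetpt (size s0) Axt (s t))).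
  by move=> Pt Qt; apply: (PQ (_, _)); split => //; exact: P'P.
suff : \forall t \near G, W (jet (f t) (xi t) (s t)) by [].
case: ff0 => [ff0|[ff0 [C [cC CA GC]] ts]].
  apply: filterS (filterI Axi (filterI GP GQ)) => t [Axt [Pt Qt]].
  rewrite ff0 -(dext_jetpt f0 Axt (ss0.1 t)).
  by apply: interior_subset; apply: VW; apply: subset_closure; exact: inV.
have /choice[D hD] : forall i : 'I_(size s0), exists C, compact C /\
    \forall t \near G, C (s t)`_i.
  by move=> i; have [D [? _ ?]] := ts i; exists D.
(* A compact set that eventually contains the arguments, by tightness and Tychonoff. *)
pose M : set (A * {ptws 'I_(size s0) -> E}) :=
  ((set_val : A -> E) @^-1` C) `*` [set y | forall i, D i (y i)].
have cM : compact M.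
  apply: compact_setX; first exact: compact_set_type.
  by apply: tychonoff => i; exact: (hD i).1.
have cMV : compact (M `&` (dext _ f0 @^-1` closure V)).
  apply: compact_closedI => //; apply: closed_comp; last exact: closed_closure.
  by move=> p _; exact: cf0.
(* Cutting [M] down to the closed part where the jet of [f0] lies in [closure V] makes [f0] itself a
   member of this compact-open neighbourhood. *)
pose O : set (Cinfty F A) :=
  [set g | dext (size s0) g @` (M `&` (dext _ f0 @^-1` closure V)) `<=` W°].
have Gf : \forall t \near G, O (f t).
  apply: (proj1 (@Cinfty_cvgP A _ G f f0 _) ff0 (size s0)
    [set g | g @` (M `&` (dext _ f0 @^-1` closure V)) `<=` W°]).
  apply: open_nbhs_nbhs; split.
    by apply: compact_open_open => //; exact: open_interior.
  by move=> _ [p [_ Vp] <-]; exact: VW.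
have GD : \forall t \near G, forall i, D i (s t)`_i.
  by apply: filter_forall => i; exact: (hD i).2.
apply: filterS (filterI (filterI Axi (filterI GP GQ))
  (filterI Gf (filterI GC GD))) => t [[Axt [Pt Qt]] [ft [Ct Dt]]].
rewrite -(dext_jetpt (f t) Axt (ss0.1 t)).
apply: interior_subset; apply: ft.
exists (jetpt (size s0) Axt (s t)) => //.
by split => //; apply: subset_closure; exact: inV.
Qed.
End jets.

(** * Convergence tested on jets, uniqueness of jets, and smooth functions built from jets *)

Section jets_theory.
Context {K : realType} {E F : lcsType K}.
Implicit Types (A : set E).

(** Converse to [jet_cvg]: continuous convergence of jets along tight families gives convergence in
    the compact-open $C^\infty$-topology. Compactness of [C], in its near-covering form, reduces
    uniform control on [C] to control near each of its points. *)
Lemma cvg_Cinfty A (T : Type) (G : set_system T) (theta : T -> Cinfty F A)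
    (theta0 : Cinfty F A) : Filter G ->
  (forall (T' : Type) (H : set_system T') (pi : T' -> T) (xi : T' -> E) x s s0,
    Filter H -> pi @ H --> G -> xi @ H --> x -> (forall t, A (xi t)) -> A x ->
    seq_cvg 0 H s s0 -> tight H A xi -> tight_seq 0 H s ->
    jet (theta (pi t)) (xi t) (s t) @[t --> H] --> jet theta0 x s0) ->
  theta @ G --> theta0.
Proof.
move=> FG ctheta; apply: (proj2 (@Cinfty_cvgP _ _ _ _ _ _ _ _ FG)) => j.
apply: (proj2 (compact_open_cvgP _ _)) => C O cC oO CO.
have /compact_near_coveringP/near_covering_withinP := cC.
suff h : forall k, C k -> \forall k' \near k & t \near G,
    C k' -> O (dext j (theta t) k').
  move=> /(_ T G (fun t k => O (dext j (theta t) k)) FG h).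
  by apply: filterS => t tO _ [k Ck <-]; exact: tO.
move=> k Ck.
pose H := filter_prod G (within C (nbhs k)).
have [c1 c2] := cvg_codom k.
have toC : snd @ H --> within C (nbhs k) by exact: cvg_snd.
have tok : snd @ H --> k by apply: cvg_trans toC _; exact: cvg_within.
(* The second component eventually stays in the compact set [C]; this is what makes points and
   directions tight along [H]. *)
have HC : \forall p \near H, C p.2 by apply: toC; exact: withinT.
have cH : jet (theta p.1) (set_val p.2.1) (codom p.2.2) @[p --> H] -->
    jet theta0 (set_val k.1) (codom k.2).
  apply: ctheta.
  - exact: cvg_fst.
  - exact: cvg_comp tok c1.
  - by move=> p; exact: set_valP.
  - exact: set_valP.
  - exact: seq_cvg_comp tok c2.
  - exists ((set_val \o fst) @` C); split.
    + apply: continuous_compact => //; apply: continuous_subspaceT => q.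
      exact: (cvg_codom q).1.
    + by move=> _ [q _ <-]; exact: set_valP.
    + by apply: filterS HC => p Cp; exists p.2.
  - move=> i; exists ((fun q : A * {ptws 'I_j -> E} => (codom q.2)`_i) @` C).
    split=> //.
    + apply: continuous_compact => //; apply: continuous_subspaceT => q.
      exact: (cvg_codom q).2.2.
    + by apply: filterS HC => p Cp; exists p.2.
have nO : nbhs (jet theta0 (set_val k.1) (codom k.2)) O.
  apply: open_nbhs_nbhs; split=> //.
  by apply: CO; exists k => //; rewrite (surjective_pairing k) dext_jet_codom.
have [[P Q] /= [GP nQ] PQ] := cH _ nO.
exists (fun k' => C k' -> Q k', P) => //= -[k' t] /= [CQ Pt] Ck'.
rewrite (surjective_pairing k') dext_jet_codom.
exact: (PQ (t, k') (conj Pt (CQ Ck'))).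
Qed.

(** Regularity in filter form: boundary points can be approached from the interior, so limits taken
    that way are unique. *)
Lemma regular_within A x : regular_set A -> A x ->
  ProperFilter (within A° (nbhs x)).
Proof. by move=> rA Ax; apply: within_nbhs_proper; exact: rA. Qed.

Lemma jet_jet_cont A (f : Cinfty F A) : jet_cont A (jet f).
Proof.
move=> T G xi x s s0 FG xix Axi Ax ss0.
by apply: (@jet_cvg _ _ _ _ _ _ (fun=> f)) => //; left.
Qed.

(** In the interior, induction on the list of directions and uniqueness of derivatives; at other
    points of [A], continuity of both sides along the interior. *)
Lemma jet_uniq A (f : Cinfty F A) J : regular_set A ->
  jet_cont A J -> jet_deriv A J ->
  (forall x, A° x -> J x [::] = jet f x [::]) ->
  forall x s, A x -> J x s = jet f x s.
Proof.
move=> rA cJ dJ J0.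
have JA : forall s x, A° x -> J x s = jet f x s.
  elim/last_ind => [//|s v IH] x Ax.
  suff d : dquot (J^~ s) v x t @[t --> 0^'] --> jet f x (rcons s v).
    exact: (cvg_unique (@lcs_hausdorff K F) (dJ s v x Ax) d).
  apply: dquot_cvg_near (@jet_jet_deriv _ _ _ _ f s v x Ax).
  have := open_nbhs_nbhs (conj (open_interior A) Ax).
  by apply: filterS => y Ay; rewrite IH.
move=> x s Ax.
have PF := regular_within rA Ax.
have wx : id @ within A° (nbhs x) --> x by exact: cvg_within.
have wA : \forall y \near within A° (nbhs x), A y.
  by apply: filterS (withinT _ _); exact: interior_subset.
have c1 : J y s @[y --> within A° (nbhs x)] --> J x s.
  by apply: (cJ _ _ id _ (fun=> s)) => //; exact: seq_cvg_cst.
suff c2 : J y s @[y --> within A° (nbhs x)] --> jet f x s.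
  exact: (cvg_unique (@lcs_hausdorff K F) c1 c2).
have c : jet f y s @[y --> within A° (nbhs x)] --> jet f x s.
  by apply: (@jet_jet_cont A f _ _ id _ (fun=> s)) => //; exact: seq_cvg_cst.
apply: cvg_trans c; apply: near_eq_cvg.
by apply: filterS (withinT _ _) => y Ay /=; rewrite JA.
Qed.

(** In the interior [J] agrees with the iterated derivatives of [f], so it is itself the continuous
    extension that smoothness asks for. *)
Lemma smooth_of_jet A (f : A -> F) J : jet_cont A J -> jet_deriv A J ->
  (forall x : A, J (val x) [::] = f x) -> smooth f.
Proof.
move=> cJ dJ J0.
have contJ j :
    continuous (fun p : A * {ptws 'I_j -> E} => J (val p.1) (codom p.2)).
  move=> p; have [c1 c2] := cvg_codom p.
  apply: cJ c1 _ _ c2; last exact: set_valP.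
  by apply: nearW => q; exact: set_valP.
have JA : forall s x, A° x -> iter_dderiv ('valL_0 f) s x = J x s.
  elim/last_ind => [|s v IH] x Ax.
    rewrite -[iter_dderiv _ _]/('valL_0 f).
    by rewrite (valL_in f (mem_set (interior_subset Ax))) -J0.
  rewrite iter_dderiv_rcons; apply: dderivE.
  apply: dquot_cvg_near (dJ s v x Ax).
  have := open_nbhs_nbhs (conj (open_interior A) Ax).
  by apply: filterS => y Ay; rewrite IH.
split.
- move=> x; have -> : f = fun y => J (val y) [::] by apply/funext => y.
  apply: (cJ _ (nbhs x) (fun y : A => val y) (val x) (fun=> [::])).
  + exact: (@initial_continuous _ _ (val : A -> E) x).
  + by apply: nearW => y; exact: set_valP.
  + exact: set_valP.
  + exact: seq_cvg_cst.
- move=> s v x Ax; exists (J x (rcons s v)).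
  apply: dquot_cvg_near (dJ s v x Ax).
  have := open_nbhs_nbhs (conj (open_interior A) Ax).
  by apply: filterS => y Ay; rewrite JA.
- move=> j _; exists (fun p => J (val p.1) (codom p.2)); split=> // x y Ax.
  by rewrite JA.
Qed.

Definition Cinfty_of_jet A (f : A -> F) J (cJ : jet_cont A J)
    (dJ : jet_deriv A J) (J0 : forall x : A, J (val x) [::] = f x) :
    Cinfty F A :=
  MkCinfty (asboolT (smooth_of_jet cJ dJ J0)).

Lemma jet_Cinfty_of_jet A (f : A -> F) J (cJ : jet_cont A J)
    (dJ : jet_deriv A J) (J0 : forall x : A, J (val x) [::] = f x) :
  regular_set A ->
  forall x s, A x -> jet (Cinfty_of_jet cJ dJ J0) x s = J x s.
Proof.
move=> rA x s Ax; rewrite (@jet_uniq A (Cinfty_of_jet cJ dJ J0) J)//.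
move=> {}x {}Ax; pose x' : A := exist _ x (mem_set (interior_subset Ax)).
by rewrite -[x]/(val x') jet_nil J0.
Qed.

(** The combination of the two jets is continuous and closed under differentiation, so [jet_uniq]
    applies. *)
Lemma jet_lin A (a : K) (f g : Cinfty F A) x s : regular_set A -> A x ->
  jet (a *: f + g) x s = a *: jet f x s + jet g x s.
Proof.
move=> rA Ax.
rewrite -(@jet_uniq A (a *: f + g) (fun x s => a *: jet f x s + jet g x s))//.
- move=> T G xi y r r0 FG xiy Axi Ay rr0.
  by apply: tvs_cvg_lin; exact: jet_jet_cont.
- by move=> r v y Ay; apply: dquot_lin; exact: jet_jet_deriv.
- move=> y Ay; pose y' : A := exist _ y (mem_set (interior_subset Ay)).
  by rewrite -[y]/(val y') !jet_nil.
Qed.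

End jets_theory.

Section jets_vector.
Context {K : realType} {E F : lcsType K} (A : set E).
Hypothesis A_regular : regular_set A.

Lemma jet0 x s : A x -> jet (0 : Cinfty F A) x s = 0.
Proof.
move=> Ax; have := jet_lin 1 (0 : Cinfty F A) 0 s A_regular Ax.
rewrite scaler0 addr0 scale1r => /eqP.
by rewrite -subr_eq0 opprD addrA subrr add0r oppr_eq0 => /eqP.
Qed.

Lemma jetZB (a : K) (f g : Cinfty F A) x s : A x ->
  jet (a *: (f - g)) x s = a *: (jet f x s - jet g x s).
Proof.
move=> Ax; rewrite -[a *: (f - g)]addr0 jet_lin// jet0// addr0.
by rewrite addrC -scaleN1r jet_lin// scaleN1r addrC.
Qed.

End jets_vector.

(** * Fibers of smooth functions on a product *)

Section fibers.
Context {K : realType} {E V F : lcsType K} (R : set E) (S : set V).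
Hypotheses (R_regular : regular_set R) (S_regular : regular_set S).
Implicit Types f : Cinfty F (R `*` S).

Lemma interiorX : (R `*` S)° = R° `*` S°.
Proof.
apply/seteqP; split=> -[x y] /=.
  move=> [[P Q] /= [nP nQ] PQ]; split.
    apply: filterS nP => z Pz.
    by have [] := PQ (z, y) (conj Pz (nbhs_singleton nQ)).
  apply: filterS nQ => z Qz.
  by have [] := PQ (x, z) (conj (nbhs_singleton nP) Qz).
by move=> [Rx Sy]; exists (R, S).
Qed.

Lemma regular_setX : regular_set (R `*` S).
Proof.
move=> [x y] [/= Rx Sy] B [[P Q] /= [nP nQ] PQ].
have [x' [Rx' Px']] := R_regular Rx nP.
have [y' [Sy' Qy']] := S_regular Sy nQ.
by exists (x', y'); split; [rewrite interiorX|exact: PQ].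
Qed.

Definition inE1 (us : seq E) : seq (E * V)%type := map (fun u => (u, 0)) us.
Definition inE2 (vs : seq V) : seq (E * V)%type := map (fun v => (0, v)) vs.

Lemma dquot_pair1 (g : (E * V)%type -> F) u x y (t : K) :
  dquot g (u, 0) (x, y) t = dquot (fun x' => g (x', y)) u x t.
Proof.
rewrite /dquot; congr (_ *: (g _ - _)).
by congr pair; rewrite /= scaler0 add0r.
Qed.

Lemma dquot_pair2 (g : (E * V)%type -> F) v x y (t : K) :
  dquot g (0, v) (x, y) t = dquot (fun y' => g (x, y')) v y t.
Proof.
rewrite /dquot; congr (_ *: (g _ - _)).
by congr pair; rewrite /= scaler0 add0r.
Qed.

Lemma near_interior (W : topologicalType) (A : set W) (x : W) : A° x ->
  \forall y \near x, A° y.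
Proof.
by move=> Ax; apply: open_nbhs_nbhs; split => //; exact: open_interior.
Qed.

Lemma near_within_interior (W : topologicalType) (A : set W) (x : W) :
  \forall y \near within A° (nbhs x), A° y.
Proof. exact: withinT. Qed.

(** For [x] in the interior this is a property of the jet of [f]. A boundary point is the limit of
    interior ones, and [dquot_lim] carries differentiability in the second variable over to the
    limit. *)
Lemma jet_deriv_pair2 f x s : R x ->
  jet_deriv S (fun y vs => jet f (x, y) (s ++ inE2 vs)).
Proof.
move=> Rx vs v y Sy; have PF := regular_within R_regular Rx.
have wx : id @ within R° (nbhs x) --> x by exact: cvg_within.
have wR : \forall x' \near within R° (nbhs x), R x'.
  by apply: filterS (near_within_interior _ _); exact: interior_subset.
apply: (@dquot_lim _ _ _ _ (within R° (nbhs x)) _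
  (fun x' y' => jet f (x', y') (s ++ inE2 vs))
  (fun x' y' => jet f (x', y') (s ++ inE2 (rcons vs v)))).
- exists (R°, S°).
    by split => /=; [exact: near_within_interior|exact: near_interior].
  move=> [x' y'] [/= Rx' Sy'].
  have := @jet_jet_deriv _ _ _ _ f (s ++ inE2 vs) (0, v) (x', y').
  rewrite interiorX /inE2 map_rcons rcons_cat => /(_ (conj Rx' Sy')).
  apply: cvg_trans; apply: near_eq_cvg; apply: nearW => t.
  by rewrite dquot_pair2.
- rewrite (_ : (fun p => _) =
      fun p => jet f (p.1, p.2) (s ++ inE2 (rcons vs v))) //.
  apply: (@jet_jet_cont _ _ _ _ f _ _ (fun p => (p.1, p.2)) _ (fun=> _)).
  + apply: cvg_pair; first by apply: cvg_trans wx; exact: cvg_fst.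
    exact: cvg_snd.
  + exists (R, S°); first by split => //=; exact: near_interior.
    by move=> [x' y'] [/= Rx' /interior_subset Sy'].
  + by split => //; exact: interior_subset.
  + exact: seq_cvg_cst.
- apply: filterS (near_interior Sy) => y' /interior_subset Sy'.
  apply: (@jet_jet_cont _ _ _ _ f _ _ (fun x' => (x', y')) _ (fun=> _)) => //.
  + by apply: cvg_pair => //; exact: cvg_cst.
  + by apply: filterS wR.
  + exact: seq_cvg_cst.
Qed.

(** The same limiting argument, with [y] approached from the interior of [S]. *)
Lemma jet_deriv_pair1 f y s : S y ->
  jet_deriv R (fun x us => jet f (x, y) (s ++ inE1 us)).
Proof.
move=> Sy us u x Rx; have PF := regular_within S_regular Sy.
have wy : id @ within S° (nbhs y) --> y by exact: cvg_within.
have wS : \forall y' \near within S° (nbhs y), S y'.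
  by apply: filterS (near_within_interior _ _); exact: interior_subset.
apply: (@dquot_lim _ _ _ _ (within S° (nbhs y)) _
  (fun y' x' => jet f (x', y') (s ++ inE1 us))
  (fun y' x' => jet f (x', y') (s ++ inE1 (rcons us u)))).
- exists (S°, R°).
    by split => /=; [exact: near_within_interior|exact: near_interior].
  move=> [y' x'] [/= Sy' Rx'].
  have := @jet_jet_deriv _ _ _ _ f (s ++ inE1 us) (u, 0) (x', y').
  rewrite interiorX /inE1 map_rcons rcons_cat => /(_ (conj Rx' Sy')).
  apply: cvg_trans; apply: near_eq_cvg; apply: nearW => t.
  by rewrite dquot_pair1.
- apply: (@jet_jet_cont _ _ _ _ f _ _ (fun p => (p.2, p.1)) _ (fun=> _)).
  + apply: cvg_pair; first exact: cvg_snd.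
    by apply: cvg_trans wy; exact: cvg_fst.
  + exists (S, R°); first by split => //=; exact: near_interior.
    by move=> [y' x'] [/= Sy' /interior_subset Rx'].
  + by split => //; exact: interior_subset.
  + exact: seq_cvg_cst.
- apply: filterS (near_interior Rx) => x' /interior_subset Rx'.
  apply: (@jet_jet_cont _ _ _ _ f _ _ (fun y' => (x', y')) _ (fun=> _)) => //.
  + by apply: cvg_pair => //; exact: cvg_cst.
  + by apply: filterS wS.
  + exact: seq_cvg_cst.
Qed.

(** The partial derivative of [f] in the directions [us], as a function of the second variable
    alone. Selecting it by its jet makes it total in [x]; for [x] in [R], [jet_fiber] shows that
    such an element exists. *)
Definition fiber f x us : Cinfty F S :=
  xget 0 [set h : Cinfty F S | forall y vs, S y ->
    jet h y vs = jet f (x, y) (inE1 us ++ inE2 vs)].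

Lemma continuous_inE1 : continuous (fun u : E => (u, 0 : V)).
Proof. by move=> u; apply: cvg_pair => //; exact: cvg_cst. Qed.

Lemma continuous_inE2 : continuous (fun v : V => (0 : E, v)).
Proof. by move=> v; apply: cvg_pair => //; exact: cvg_cst. Qed.

Lemma seq_cvg_inE T (G : set_system T) (us : T -> seq E) us0
    (vs : T -> seq V) vs0 : Filter G ->
  seq_cvg 0 G us us0 -> seq_cvg 0 G vs vs0 ->
  seq_cvg (0 : (E * V)%type) G (fun t => inE1 (us t) ++ inE2 (vs t))
    (inE1 us0 ++ inE2 vs0).
Proof.
move=> FG cu cv; apply: seq_cvg_cat.
  by apply: seq_cvg_map cu => //; exact: continuous_inE1.
by apply: seq_cvg_map cv => //; exact: continuous_inE2.
Qed.

Lemma jet_fiber f x us y vs : R x -> S y ->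
  jet (fiber f x us) y vs = jet f (x, y) (inE1 us ++ inE2 vs).
Proof.
move=> Rx; rewrite /fiber; case: xgetP => [h _ /= hE Sy|noh]; first exact: hE.
exfalso.
pose J y vs := jet f (x, y) (inE1 us ++ inE2 vs).
have cJ : jet_cont S J.
  move=> T G xi z s s0 FG xiz Sxi Sz ss0.
  apply: (@jet_jet_cont _ _ _ _ f _ _ (fun t => (x, xi t)) _
    (fun t => inE1 us ++ inE2 (s t))) => //.
  - by apply: cvg_pair => //; exact: cvg_cst.
  - by apply: filterS Sxi.
  - by apply: seq_cvg_inE => //; exact: seq_cvg_cst.
have dJ : jet_deriv S J by exact: jet_deriv_pair2.
apply: (noh (Cinfty_of_jet cJ dJ (fun=> erefl))) => /= z vs' Sz.
exact: jet_Cinfty_of_jet.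
Qed.

(** [cvg_Cinfty] supplies tight points and directions for the second variable. Paired with those
    assumed for the first they stay tight, so [jet_cvg] applies on the product. *)
Lemma fiber_cvg T (G : set_system T) (f : T -> Cinfty F (R `*` S)) f0
    (x : T -> E) x0 (us : T -> seq E) us0 : Filter G ->
  (forall t, f t = f0) \/ [/\ f @ G --> f0, tight G R x & tight_seq 0 G us] ->
  x @ G --> x0 -> (\forall t \near G, R (x t)) -> R x0 -> seq_cvg 0 G us us0 ->
  fiber (f t) (x t) (us t) @[t --> G] --> fiber f0 x0 us0.
Proof.
move=> FG ff0 xx0 Rx Rx0 cus; apply: cvg_Cinfty => T' H pi xi y s s0.
move=> FH piG xiy Sxi Sy ss0 txi ts; rewrite jet_fiber//.
have Rpi : \forall t \near H, R (x (pi t)) := piG _ Rx.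
have cus' : seq_cvg 0 H (us \o pi) us0 by exact: seq_cvg_comp piG cus.
suff : jet (f (pi t)) (x (pi t), xi t) (inE1 (us (pi t)) ++ inE2 (s t))
    @[t --> H] --> jet f0 (x0, y) (inE1 us0 ++ inE2 s0).
  apply: cvg_trans; apply: near_eq_cvg.
  by apply: filterS Rpi => t Rt; rewrite jet_fiber.
apply: (@jet_cvg _ _ _ _ _ H (f \o pi) f0 (fun t => (x (pi t), xi t)) _
    (fun t => inE1 (us (pi t)) ++ inE2 (s t))).
- case: ff0 => [ff0|[ff0 tx tus]]; [by left=> t; exact: ff0|right; split].
  + exact: cvg_comp piG ff0.
  + exact: tight_pair (tight_comp piG tx) txi.
  + apply: (tight_seq_cat (n := size us0)).
    * by move=> t; rewrite size_map cus.1.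
    * apply: (@tight_seq_map _ _ 0 0 _ _ _ _ (us \o pi)) => //.
        exact: continuous_inE1.
      by move=> i; exact: tight_comp piG (tus i).
    * by apply: (@tight_seq_map _ _ 0 0) => //; exact: continuous_inE2.
- by apply: cvg_pair => //; exact: cvg_comp piG xx0.
- by apply: filterS Rpi => t Rt; split => //=.
- by split.
- exact: seq_cvg_inE.
Qed.

(** Quotients in the first variable converge even while the second variable and its directions move:
    the derivatives along the short segment from [x] lie in one convex set, and the mean value
    theorem passes this on to the quotients. *)
Lemma dquot_jet_cvg f x us u T (G : set_system T) (tau : T -> K) (y : T -> V) y0
    (vs : T -> seq V) vs0 : Filter G -> R° x ->
  tau @ G --> 0^' -> y @ G --> y0 -> (\forall t \near G, S (y t)) -> S y0 ->
  seq_cvg 0 G vs vs0 ->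
  dquot (fun x' => jet f (x', y t) (inE1 us ++ inE2 (vs t))) u x (tau t)
    @[t --> G] --> jet f (x, y0) (rcons (inE1 us ++ inE2 vs0) (u, 0)).
Proof.
move=> FG Rx tau0 yy0 Sy Sy0 cvs W nW.
have [C [cC oC Cl CW]] := nbhs_convex nW.
have nC : nbhs (jet f (x, y0) (rcons (inE1 us ++ inE2 vs0) (u, 0))) C.
  exact: open_nbhs_nbhs.
have Rline : \forall r \near (0 : K), R° (r *: u + x).
  exact: (cvg_line u cvg_id (near_interior Rx)).
have c : jet f (p.2 *: u + x, y p.1) (rcons (inE1 us ++ inE2 (vs p.1)) (u, 0))
    @[p --> filter_prod G (nbhs (0 : K))] -->
    jet f (x, y0) (rcons (inE1 us ++ inE2 vs0) (u, 0)).
  apply: (@jet_jet_cont _ _ _ _ f _ _ (fun p => (p.2 *: u + x, y p.1)) _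
    (fun p => rcons (inE1 us ++ inE2 (vs p.1)) (u, 0))).
  - apply: cvg_pair; first by apply: cvg_line; exact: cvg_snd.
    by apply: cvg_comp yy0; exact: cvg_fst.
  - exists ([set t | S (y t)], [set r | R° (r *: u + x)]) => //.
    by move=> [t r] [/= St /interior_subset Rr].
  - by split => //; exact: interior_subset.
  - apply: seq_cvg_rcons; last exact: cvg_cst.
    apply: seq_cvg_inE; first exact: seq_cvg_cst.
    by apply: seq_cvg_comp cvs; exact: cvg_fst.
have [[P Q] /= [GP nQ] PQ] := c _ nC.
have [e /= e0 he] := filterI nQ Rline.
have tau_e : \forall t \near G, `|tau t| < e /\ tau t != 0.
  apply: (tau0 [set r | `|r| < e /\ r != 0]).
  by exists e => // r /=; rewrite sub0r normrN => re r0; split.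
suff : \forall t \near G, C (dquot (fun x' => jet f (x', y t)
    (inE1 us ++ inE2 (vs t))) u x (tau t)).
  by apply: filterS => t Ct; apply: CW; exact: subset_closure.
apply: filterS (filterI (filterI GP Sy) tau_e) => t [[Pt St] [te tn0]].
apply: mean_value_dquot => // r rt.
have [Qr Rr] : (Q `&` [set r | R° (r *: u + x)]) r.
  by apply: he; rewrite /= sub0r normrN; exact: le_lt_trans te.
(* With the whole list as prefix and no further directions, differentiation appends [(u, 0)] at the
   very end. *)
have := @jet_deriv_pair1 f (y t) (inE1 us ++ inE2 (vs t)) St [::] u _ Rr.
rewrite /= cats1 cats0; apply; apply: open_nbhs_nbhs; split => //.
exact: (PQ (t, r)).
Qed.

(* A form of Schwarz' theorem: the right-hand side is the limit of the jets of
   the difference quotients of the fibers, hence is itself a jet, and it has the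
   same values as the left-hand side. *)
Lemma jet_fiber_rcons f x us u y vs : R° x -> S y ->
  jet (fiber f x (rcons us u)) y vs =
  jet f (x, y) (rcons (inE1 us ++ inE2 vs) (u, 0)).
Proof.
move=> Rx0 Sy; have Rx := interior_subset Rx0.
have line0 : (t *: u + x) @[t --> (0 : K)^'] --> x.
  by apply: cvg_line; exact: nbhs_dnbhs.
have Rline : \forall t \near (0 : K)^', R (t *: u + x).
  by have := line0 _ (near_interior Rx0); apply: filterS => t /interior_subset.
(* These quotients are elements of $C^\infty(S,F)$, hence have jets, which are quotients of jets of
   [f] in the first variable. *)
pose Q t := t^-1 *: (fiber f (t *: u + x) us - fiber f x us).
have jetQ t z ws : R (t *: u + x) -> S z -> jet (Q t) z ws =
    dquot (fun x' => jet f (x', z) (inE1 us ++ inE2 ws)) u x t.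
  by move=> Rt Sz; rewrite jetZB// !jet_fiber.
apply/esym; apply: (@jet_uniq _ _ _ _ _
  (fun y vs => jet f (x, y) (rcons (inE1 us ++ inE2 vs) (u, 0)))) => //.
- move=> T G xi z s s0 FG xiz Sxi Sz ss0.
  apply: (@jet_jet_cont _ _ _ _ f _ _ (fun t => (x, xi t)) _
    (fun t => rcons (inE1 us ++ inE2 (s t)) (u, 0))) => //.
  + by apply: cvg_pair => //; exact: cvg_cst.
  + by apply: filterS Sxi.
  + apply: seq_cvg_rcons; last exact: cvg_cst.
    by apply: seq_cvg_inE => //; exact: seq_cvg_cst.
- move=> s v z Sz; have Sz' := interior_subset Sz.
  have PF : ProperFilter (0 : K)^' by exact: Proper_dnbhs_numFieldType.
  apply: (@dquot_lim _ _ _ _ (0 : K)^' _ (fun t z => jet (Q t) z s)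
    (fun t z => jet (Q t) z (rcons s v))).
  + exists (setT, S°).
      by split => /=; [exact: filterT|exact: near_interior].
    by move=> [t z'] [_ Sz'']; exact: jet_jet_deriv.
  + have c : dquot (fun x' =>
        jet f (x', p.2) (inE1 us ++ inE2 (rcons s v))) u x p.1
        @[p --> filter_prod (0 : K)^' (nbhs z)] -->
        jet f (x, z) (rcons (inE1 us ++ inE2 (rcons s v)) (u, 0)).
      apply: (@dquot_jet_cvg f x us u _ _ fst snd z (fun=> rcons s v)) => //.
      * exact: cvg_fst.
      * exact: cvg_snd.
      * apply: cvg_snd; apply: filterS (near_interior Sz).
        exact: interior_subset.
      * exact: seq_cvg_cst.
    apply: cvg_trans c; apply: near_eq_cvg.
    exists ([set t | R (t *: u + x)], S°).
      by split => //=; exact: near_interior.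
    by move=> [t z'] [/= Rt /interior_subset Sz'']; rewrite jetQ.
  + apply: filterS (near_interior Sz) => z' /interior_subset Sz''.
    have c : dquot (fun x' => jet f (x', z') (inE1 us ++ inE2 s)) u x t
        @[t --> (0 : K)^'] --> jet f (x, z') (rcons (inE1 us ++ inE2 s) (u, 0)).
      apply: (@dquot_jet_cvg f x us u _ _ id (fun=> z') z' (fun=> s)) => //.
      * exact: cvg_cst.
      * exact: nearW.
      * exact: seq_cvg_cst.
    apply: cvg_trans c; apply: near_eq_cvg.
    by apply: filterS Rline => t Rt; rewrite jetQ.
(* With no directions in [V], [(u, 0)] comes last in both orders and the two sides coincide. *)
- move=> z /interior_subset Sz.
  by rewrite jet_fiber// /inE1 map_rcons !cats0.
Qed.

(** The convergence takes place in $C^\infty(S,F)$, so that [Phi] can be applied to it; [cvg_Cinfty]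
    and [jet_fiber_rcons] reduce it to [dquot_jet_cvg]. *)
Lemma fiber_dquot f x us u : R° x ->
  t^-1 *: (fiber f (t *: u + x) us - fiber f x us) @[t --> (0 : K)^'] -->
    fiber f x (rcons us u).
Proof.
move=> Rx0; have Rx := interior_subset Rx0.
have Rline : \forall t \near (0 : K)^', R (t *: u + x).
  have line0 : (t *: u + x) @[t --> (0 : K)^'] --> x.
    by apply: cvg_line; exact: nbhs_dnbhs.
  by have := line0 _ (near_interior Rx0); apply: filterS => t /interior_subset.
apply: cvg_Cinfty => T H pi xi y s s0 FH pi0 xiy Sxi Sy ss0 _ _.
rewrite jet_fiber_rcons//.
have nS : \forall t \near H, S (xi t) by exact: nearW.
have c := @dquot_jet_cvg f x us u _ _ pi xi y s s0 FH Rx0 pi0 xiy nS Sy ss0.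
apply: cvg_trans c; apply: near_eq_cvg.
have Rpi : \forall t \near H, R (pi t *: u + x) := pi0 _ Rline.
apply: filterS Rpi => t Rt.
by rewrite jetZB// !jet_fiber.
Qed.

End fibers.

(** * The extension operator *)

Section extension.
Context {K : realType} {E V F : lcsType K} (R : set E) (S : set V).
Hypotheses (R_regular : regular_set R) (S_regular : regular_set S).
Hypothesis V_locally_compact : forall y : V, exists2 C, compact C & nbhs y C.
Context (Phi : {linear Cinfty F S -> Cinfty F [set: V]}).
Hypothesis Phi_continuous : continuous Phi.
Implicit Types f : Cinfty F (R `*` S).

(** Derivatives in [E] are taken before [Phi] is applied, those in [V] afterwards. *)
Definition ext f (z : (E * V)%type) us vs := jet (Phi (fiber f z.1 us)) z.2 vs.

Lemma regular_setT (T : topologicalType) : regular_set [set: T].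
Proof. by move=> x _; rewrite interiorT closureT. Qed.

(** Local compactness of [V] turns convergence into tightness, as needed to evaluate varying values
    of [Phi] at moving points and directions. *)
Lemma cvg_tight T (G : set_system T) (y : T -> V) (y0 : V) : Filter G ->
  y @ G --> y0 -> tight G setT y.
Proof.
move=> FG yy0; have [C cC nC] := V_locally_compact y0.
by exists C; split => //; exact: yy0 _ nC.
Qed.

Lemma ext_cvg T (G : set_system T) (f : T -> Cinfty F (R `*` S)) f0
    (z : T -> (E * V)%type) z0 (us : T -> seq E) us0 (vs : T -> seq V) vs0 :
  Filter G ->
  (forall t, f t = f0) \/
    [/\ f @ G --> f0, tight G R (fst \o z) & tight_seq 0 G us] ->
  z @ G --> z0 -> (\forall t \near G, R (z t).1) -> R z0.1 ->
  seq_cvg 0 G us us0 -> seq_cvg 0 G vs vs0 ->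
  ext (f t) (z t) (us t) (vs t) @[t --> G] --> ext f0 z0 us0 vs0.
Proof.
move=> FG ff0 zz0 Rz Rz0 cus cvs.
have z1 : fst \o z @ G --> z0.1 by apply: cvg_comp zz0 _; exact: cvg_fst.
have z2 : snd \o z @ G --> z0.2 by apply: cvg_comp zz0 _; exact: cvg_snd.
apply: (@jet_cvg _ _ _ _ _ G (fun t => Phi (fiber (f t) (z t).1 (us t))) _
  (snd \o z)) => //; last exact: nearW.
right; split.
- apply: continuous_cvg; first exact: Phi_continuous.
  exact: fiber_cvg.
- exact: cvg_tight z2.
- by move=> i; apply: cvg_tight (cvs.2 i).
Qed.

(** The increment splits into a change of [x] at the displaced point [t *: v + y] and a change of
    [y] at fixed [x]. By linearity of [Phi] the former is the jet of [Phi (Q t)], which converges by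
    continuity of [Phi]. *)
Lemma ext_dquot f x y us vs u v : R° x ->
  dquot (fun z => ext f z us vs) (u, v) (x, y) t @[t --> (0 : K)^'] -->
    ext f (x, y) (rcons us u) vs + ext f (x, y) us (rcons vs v).
Proof.
move=> Rx0; have Rx := interior_subset Rx0.
have id0 : id @ (0 : K)^' --> (0 : K) by exact: nbhs_dnbhs.
pose Q t := t^-1 *: (fiber f (t *: u + x) us - fiber f x us).
have -> : dquot (fun z => ext f z us vs) (u, v) (x, y) = fun t =>
    jet (Phi (Q t)) (t *: v + y) vs + dquot (fun y => ext f (x, y) us vs) v y t.
  apply/funext => t; rewrite linearZ linearB jetZB//; last exact: regular_setT.
  by rewrite /dquot /ext /= -scalerDr addrA subrK.
apply: tvs_cvgD; last first.
  have Ty : [set: V]° y by rewrite interiorT.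
  exact: (@jet_jet_deriv _ _ _ _ (Phi (fiber f x us)) vs v y Ty).
apply: (@jet_cvg _ _ _ _ _ (0 : K)^' (Phi \o Q) _ (fun t => t *: v + y) _
    (fun=> vs)) => //.
- right; split.
  + apply: (@cvg_comp _ _ _ Q Phi _ (nbhs (fiber f x (rcons us u)))).
      exact: fiber_dquot.
    exact: Phi_continuous.
  + by apply: (@cvg_tight _ _ _ y); exact: cvg_line.
  + exact: tight_seq_cst.
- exact: cvg_line.
- exact: nearW.
- exact: seq_cvg_cst.
Qed.

(* Leibniz expansion of $D_{s_j} \cdots D_{s_1}$: each direction [(u, v)] in
   [s] is used either as [u], in the first variable, or as [v], in the second *)
Fixpoint mix f z (s : seq (E * V)%type) us vs : F :=
  if s is w :: s' then
    mix f z s' (rcons us w.1) vs + mix f z s' us (rcons vs w.2)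
  else ext f z us vs.

(** Induction moves the directions from [s] into [us] and [vs]. Their tightness in [E] is carried
    along into [us]; in [V] it comes from local compactness. *)
Lemma mix_cvg T (G : set_system T) (f : T -> Cinfty F (R `*` S)) f0
    (z : T -> (E * V)%type) z0 (s : T -> seq (E * V)%type) s0
    (us : T -> seq E) us0 (vs : T -> seq V) vs0 :
  Filter G ->
  (forall t, f t = f0) \/
    [/\ f @ G --> f0, tight G R (fst \o z),
        tight_seq (0 : (E * V)%type) G s & tight_seq 0 G us] ->
  z @ G --> z0 -> (\forall t \near G, R (z t).1) -> R z0.1 ->
  seq_cvg (0 : (E * V)%type) G s s0 -> seq_cvg 0 G us us0 ->
  seq_cvg 0 G vs vs0 ->
  mix (f t) (z t) (s t) (us t) (vs t) @[t --> G] --> mix f0 z0 s0 us0 vs0.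
Proof.
move=> FG ff0 zz0 Rz Rz0.
elim: s0 s us us0 vs vs0 ff0 => [|w0 s0 IH] s us us0 vs vs0 ff0 cs cus cvs.
  have -> : (fun t => mix (f t) (z t) (s t) (us t) (vs t)) =
      fun t => ext (f t) (z t) (us t) (vs t).
    by apply/funext => t; rewrite (size0nil (cs.1 t)).
  by apply: ext_cvg => //; case: ff0 => [?|[? ? ? ?]]; [left|right].
pose w t := nth (0 : (E * V)%type) (s t) 0; pose s' t := behead (s t).
have -> : (fun t => mix (f t) (z t) (s t) (us t) (vs t)) =
    fun t => mix (f t) (z t) (s' t) (rcons (us t) (w t).1) (vs t) +
             mix (f t) (z t) (s' t) (us t) (rcons (vs t) (w t).2).
  by apply/funext => t; rewrite /s' /w; have := cs.1 t; case: (s t).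
have cs' : seq_cvg (0 : (E * V)%type) G s' s0.
  split=> [t|i]; first by rewrite size_behead cs.1.
  rewrite (_ : (fun t => _) = fun t => nth 0 (s t) i.+1);
    first exact: (cs.2 i.+1).
  by apply/funext => t; rewrite nth_behead.
have cw : w @ G --> w0 by exact: (cs.2 0).
have cw1 : (w t).1 @[t --> G] --> w0.1 by apply: cvg_comp cw _; exact: cvg_fst.
have cw2 : (w t).2 @[t --> G] --> w0.2 by apply: cvg_comp cw _; exact: cvg_snd.
have ts' : tight_seq (0 : (E * V)%type) G s ->
    tight_seq (0 : (E * V)%type) G s'.
  move=> ts i.
  rewrite (_ : (fun t => _) = fun t => nth 0 (s t) i.+1);
    first exact: (ts i.+1).
  by apply/funext => t; rewrite nth_behead.
apply: tvs_cvgD; apply: IH => //; try exact: seq_cvg_rcons.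
- case: ff0 => [?|[? ? ts tus]]; [by left|right; split=> //; first exact: ts'].
  apply: (tight_seq_rcons (n := size us0)) => //; first exact: cus.1.
  by apply: (tight_map _ _ (ts 0)) => // p; exact: cvg_fst.
- by case: ff0 => [?|[? ? ts tus]]; [left|right; split=> //; exact: ts'].
Qed.

(** The new direction is the last of the list, hence is consumed at the leaves of the expansion,
    where [ext_dquot] splits it; linearity handles the sums above. *)
Lemma mix_dquot f z s us vs w : R° z.1 ->
  dquot (fun z => mix f z s us vs) w z t @[t --> (0 : K)^'] -->
    mix f z (rcons s w) us vs.
Proof.
move=> Rz; elim: s us vs => [|w' s IH] us vs /=.
  by case: z w Rz => x y [u v] /= Rx; exact: ext_dquot.
rewrite -[X in _ --> X + _]scale1r.
rewrite (_ : (fun z => _) = fun z => 1 *: mix f z s (rcons us w'.1) vs +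
  mix f z s us (rcons vs w'.2)); first exact: dquot_lin.
by apply/funext => z'; rewrite scale1r.
Qed.

Lemma mix_jet_cont f :
  jet_cont (R `*` [set: V]) (fun z s => mix f z s [::] [::]).
Proof.
move=> T G xi z s s0 FG xiz Rxi [Rz _] ss0.
apply: (@mix_cvg _ _ (fun=> f) _ xi _ s _ (fun=> [::]) _ (fun=> [::])) => //.
- by left.
- by apply: filterS Rxi => t [].
- exact: seq_cvg_cst.
- exact: seq_cvg_cst.
Qed.

Lemma mix_jet_deriv f :
  jet_deriv (R `*` [set: V]) (fun z s => mix f z s [::] [::]).
Proof.
by move=> s w z; rewrite interiorX => -[Rz _]; exact: mix_dquot.
Qed.

Definition extension f : Cinfty F (R `*` [set: V]) :=
  Cinfty_of_jet (@mix_jet_cont f) (@mix_jet_deriv f)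
    (fun z => erefl (ext f (val z) [::] [::])).

Lemma jet_extension f z s : R z.1 ->
  jet (extension f) z s = mix f z s [::] [::].
Proof.
move=> Rz; apply: jet_Cinfty_of_jet => //.
exact: regular_setX (@regular_setT V).
Qed.

Lemma fiber_nil f x (y : S) (Rxy : (R `*` S) (x, val y)) :
  fiber f x [::] y = f (exist _ (x, val y) (mem_set Rxy)).
Proof.
have [Rx Sy] := Rxy.
by rewrite -jet_nil jet_fiber// -jet_nil.
Qed.

Lemma extension_is_linear : linear extension.
Proof.
move=> a f g; apply: val_inj; apply/funext => z.
have [Rz _] := set_valP z.
change (ext (a *: f + g) (val z) [::] [::] =
  a *: ext f (val z) [::] [::] + ext g (val z) [::] [::]).
rewrite /ext -jet_lin//; last exact: regular_setT.
congr (jet _ _ _); rewrite -linearP; congr (Phi _).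
apply: val_inj; apply/funext => y.
have Rzy : (R `*` S) ((val z).1, val y) by split=> //; exact: set_valP.
change (fiber (a *: f + g) (val z).1 [::] y =
  a *: fiber f (val z).1 [::] y + fiber g (val z).1 [::] y).
by rewrite !(fiber_nil _ Rzy).
Qed.

(** The tight families that [cvg_Cinfty] provides meet the second alternative of [mix_cvg], in which
    [f] varies. *)
Lemma extension_continuous : continuous extension.
Proof.
move=> f; apply: (@cvg_Cinfty _ _ _ _ _ (nbhs f) extension _ (nbhs_filter f)).
move=> T H pi xi z s s0 FH pif xiz Rxi [Rz _] ss0 txi ts.
rewrite jet_extension// (_ : (fun t => _) =
  fun t => mix (pi t) (xi t) (s t) [::] [::]);
  last by apply/funext => t; rewrite jet_extension//; case: (Rxi t).
apply: mix_cvg => //.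
- right; split => //; last exact: tight_seq_cst.
  by apply: (tight_map _ _ txi) => [p|p []//]; exact: cvg_fst.
- by apply: nearW => t; case: (Rxi t).
- exact: seq_cvg_cst.
- exact: seq_cvg_cst.
Qed.

Lemma restr_extension : cancel Phi (restr (@subsetT _ S)) ->
  cancel extension (restr (setSX (@subsetT _ S) (@subset_refl _ R))).
Proof.
move=> PhiK f; apply: val_inj; apply/funext => z.
have [Rz Sz] := set_valP z.
pose y : S := exist _ (val z).2 (mem_set Sz).
pose y' : [set: V] := Defs.incl (@subsetT _ S) y.
change (ext f (val z) [::] [::] = f z).
rewrite /ext -[(val z).2]/(val y') jet_nil.
change (restr (@subsetT _ S) (Phi (fiber f (val z).1 [::])) y = f z).
rewrite PhiK.
have Rzy : (R `*` S) ((val z).1, val y) by [].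
rewrite (fiber_nil _ Rzy); congr (f _); apply: val_inj.
by rewrite /= -surjective_pairing.
Qed.

End extension.

(** * Local compactness of $\mathbb{R}^d$ and the conclusion *)

Lemma rV_locally_compact (K : realType) (d : nat) (y : 'rV[K]_d) :
  exists2 C, compact C & nbhs y C.
Proof.
exists (closed_ball y 1); last first.
  by apply: filterS (nbhsx_ballx y _ ltr01); exact: subset_closed_ball.
apply: bounded_closed_compact; last exact: closed_ball_closed.
rewrite closed_ballE /bounded_set//; exists (`|y| + 1).
split; first exact: num_real.
move=> r yr z /= zy; apply/ltW/(le_lt_trans _ yr).
have -> : z = y - (y - z) by rewrite opprB addrC subrK.
by apply: le_trans (ler_normB _ _) _; rewrite lerD.
Qed.

Theorem proposition1p9 (K : realType) (d : nat) (d_gt0 : (0 < d)%N)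
    (S : set 'rV[K]_d) (S_closed : closed S) (S_regular : regular_set S)
    (E F : lcsType K) (R : set E) (R_regular : regular_set R) :
  has_clin_right_inverse
    (restr (@subsetT _ S) :
      Cinfty F [set: 'rV[K]_d] -> Cinfty F S) ->
  has_clin_right_inverse
    (restr (setSX (@subsetT _ S) (@subset_refl _ R)) :
      Cinfty F (R `*` [set: 'rV[K]_d]) -> Cinfty F (R `*` S)).
Proof.
move=> [Phi [Phi_continuous PhiK]].
have V_locally_compact := @rV_locally_compact K d.
pose Psi0 := extension R_regular S_regular V_locally_compact Phi_continuous.
pose Psi : {linear Cinfty F (R `*` S) -> Cinfty F (R `*` [set: 'rV[K]_d])} :=
  HB.pack Psi0 (GRing.isLinear.Build _ _ _ _ Psi0
    (extension_is_linear R_regular S_regular V_locally_compact Phi_continuous)).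
exists Psi; split; first exact: extension_continuous.
exact: restr_extension.
Qed.
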